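(* Let $(A,\cdot)$ be an $n$-dimensional associative algebra over the complex field $\mathbb{C}$ with a basis $\{e_1,e_2,\dots,e_n\}$ whose non-zero products are $e_i\cdot e_j=e_{i+j}$ for $i,j\ge 1$, $2\leq i+j\leq n$ (all other products of basis elements being zero). If $n\geq 4$, then there is no compatible anti-dendriform algebra structure on $(A,\cdot)$.
   Context: An anti-dendriform algebra is a vector space $A$ with two bilinear operations $\vartriangleright,\vartriangleleft: A\otimes A\to A$ such that, writing $x\cdot y=x\vartriangleright y+x\vartriangleleft y$, for all $x,y,z\in A$: $x\vartriangleright(y\vartriangleright z)=-(x\cdot y)\vartriangleright z=-x\vartriangleleft(y\cdot z)=(x\vartriangleleft y)\vartriangleleft z$ and $(x\vartriangleright y)\vartriangleleft z=x\vartriangleright(y\vartriangleleft z)$. Then $(A,\cdot)$ is an associative algebra, called the associated associative algebra of $(A,\vartriangleright,\vartriangleleft)$, and $(A,\vartriangleright,\vartriangleleft)$ is called a compatible anti-dendriform algebra structure on $(A,\cdot)$. *)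

(* Defs.v *)
From HB Require Import structures.
From mathcomp Require Import all_boot all_order all_algebra.
From mathcomp Require Import reals complex.
Set Implicit Arguments.
Unset Strict Implicit.
Unset Printing Implicit Defensive.

Import GRing.Theory.
Local Open Scope ring_scope.

(* [rprod x y] is x \vartriangleright y and [lprod x y] is x \vartriangleleft y;
   the chain of four equal expressions is split into three equations. *)
Record antiDendriform (K : fieldType) (A : lmodType K) := AntiDendriform {
  rprod : {bilinear A -> A -> A};
  lprod : {bilinear A -> A -> A};
  rprod_rprod : forall x y z : A,
    rprod x (rprod y z) = - rprod (rprod x y + lprod x y) z;
  rprod_lprod_dot : forall x y z : A,
    - rprod (rprod x y + lprod x y) z = - lprod x (rprod y z + lprod y z);
  lprod_lprod : forall x y z : A,
    - lprod x (rprod y z + lprod y z) = lprod (lprod x y) z;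
  rprod_lprodA : forall x y z : A,
    lprod (rprod x y) z = rprod x (lprod y z)
}.

Definition assoc_prod (K : fieldType) (A : lmodType K)
  (D : antiDendriform A) (x y : A) : A := rprod D x y + lprod D x y.

Definition compatible (K : fieldType) (A : lmodType K)
  (mul : A -> A -> A) (D : antiDendriform A) : Prop :=
  forall x y : A, assoc_prod D x y = mul x y.

(* Sequences are 0-based while the basis is e_1, ..., e_n: e_k is [e`_k.-1],
   used only for 1 <= k <= n. *)
Definition null_filiform_basis (K : fieldType) (A : vectType K)
  (mul : A -> A -> A) (n : nat) (e : n.-tuple A) : Prop :=
  basis_of fullv e /\
  forall i j : nat, (1 <= i <= n)%N -> (1 <= j <= n)%N ->
    mul e`_i.-1 e`_j.-1 = if (i + j <= n)%N then e`_(i + j).-1 else 0.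

(* Main.v *)
Require Import Defs.
From HB Require Import structures.
From mathcomp Require Import all_boot all_order all_algebra.
From mathcomp Require Import reals complex.
Set Implicit Arguments.
Unset Strict Implicit.
Unset Printing Implicit Defensive.

Import GRing.Theory.
Local Open Scope ring_scope.

(** Every anti-dendriform algebra, over any field, satisfies [3 (wxyz) = 0]
    for its associated product ([assoc_prod4_mul3_eq0]); away from
    characteristic 3 its fourth power therefore vanishes, whereas the algebra
    of the theorem has [e_1 e_1 e_1 e_1 = e_4 <> 0] as soon as [n >= 4].

    Write > and < for the two operations.  The axioms let a factor cross from
    one argument to the other at the price of exchanging the operations:
    [(xy) > z = x < (yz)] and [(xy) < z = x > (yz)].  Starting from
    [(wx) > (yz)], let [x] cross to the right, then [xy] to the left, then [y]
    to the right: after three crossings the product is split as it was at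
    first, but the operation is now <.  So [(wx) > (yz)] and [(wx) < (yz)]
    have a common value [h], and [wxyz = 2 h]; one more crossing gives
    [w > (xyz) = h].  On the other hand
    [xyz = x < (yz) + x > (yz) = (xy) > z + x > (yz)], and
    [a > (b > c) = - (ab) > c] turns both terms of [w > (xyz)] into [- h].
    So [h = - 2 h], that is [3 h = 0]. *)

Section AntiDendriform.

Variables (K : fieldType) (A : lmodType K) (D : antiDendriform A).
Implicit Types w x y z : A.

Local Notation "x |> y" := (rprod D x y) (at level 40, left associativity).
Local Notation "x <| y" := (lprod D x y) (at level 40, left associativity).
Local Notation "x ** y" := (assoc_prod D x y)
  (at level 40, left associativity).

Lemma rprod_rprodN x y z : x |> (y |> z) = - (x ** y |> z).
Proof. exact: rprod_rprod. Qed.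

Lemma rprod_dotl x y z : x ** y |> z = x <| (y ** z).
Proof. by apply: oppr_inj; exact: rprod_lprod_dot. Qed.

(** Both sides are the sum of [x |> (y <| z)] and [x |> (y |> z)], the chain of
    axioms identifying the latter with [(x <| y) <| z]. *)
Lemma lprod_dotl x y z : x ** y <| z = x |> (y ** z).
Proof.
rewrite /assoc_prod linearDl linearDr /= rprod_lprodA -lprod_lprod.
by rewrite -rprod_lprod_dot -rprod_rprod addrC.
Qed.

Lemma assoc_prodA x y z : x ** y ** z = x ** (y ** z).
Proof.
by rewrite {1}/assoc_prod rprod_dotl lprod_dotl addrC.
Qed.

(** The value [h] of one splitting is computed twice: as a single splitting, and
    after expanding [x ** (y ** z)] under [w |>], where the minus sign of
    [rprod_rprodN] appears. *)
Lemma assoc_prod4_mul3_eq0 w x y z : (w ** x ** (y ** z)) *+ 3 = 0.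
Proof.
set h := w ** x |> (y ** z).
have w_lprod : w <| (x ** (y ** z)) = h by rewrite -rprod_dotl.
(* x crossed alone but returns with y: this gives the circuit of crossings an
   odd length, so that it closes in wx_lprod with < in place of >. *)
have wxy_rprod : w ** x ** y |> z = h.
  by rewrite assoc_prodA rprod_dotl assoc_prodA.
have wx_lprod : w ** x <| (y ** z) = h by rewrite -rprod_dotl.
have w_rprod : w |> (x ** (y ** z)) = h by rewrite -lprod_dotl.
have hN2 : h = - h - h.
  rewrite -[LHS]w_rprod {1}/assoc_prod linearDr /= -rprod_dotl !rprod_rprodN.
  by rewrite -assoc_prodA wxy_rprod.
have h3 : h *+ 3 = 0.
  by rewrite !mulrS mulr0n addr0 {1}hN2 -opprD addNr.
by rewrite /assoc_prod -/(w ** x) -/(y ** z) wx_lprod mulrnDl h3 addr0.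
Qed.

End AntiDendriform.

Theorem theorem3p1 (R : realType) (n : nat) (A : vectType R[i])
  (mul : {bilinear A -> A -> A}) (e : n.-tuple A)
  (mulA : associative mul) (dimA : \dim {:A} = n)
  (basis_e : null_filiform_basis mul e) (n_ge4 : (4 <= n)%N) :
  ~ exists D : antiDendriform A, compatible mul D.
Proof.
case=> D mulE; case: basis_e => e_basis mul_e.
have e2E : mul e`_0 e`_0 = e`_1.
  by rewrite (mul_e 1 1)%N ?(leq_trans _ n_ge4).
have e4E : mul e`_1 e`_1 = e`_3.
  by rewrite (mul_e 2 2)%N ?(leq_trans _ n_ge4).
have e4_neq0 : e`_3 != 0.
  by apply: (free_not0 (basis_free e_basis)); rewrite mem_nth ?size_tuple.
have := assoc_prod4_mul3_eq0 D e`_0 e`_0 e`_0 e`_0.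
rewrite !mulE e2E e4E => /eqP.
by rewrite -scaler_nat scaler_eq0 (negPf e4_neq0) orbF Num.Theory.pnatr_eq0.
Qed.
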